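(* Let $\mathcal C=(F_v,F_e,\mathcal T)$ be a crystal framework in $\mathbb R^d$ and let $g$ be a separable symmetry of $\mathcal G(\mathcal C)$ or a symmetry which acts on $F_v$. Then $$m_g-s_g=\dim\mathcal F_g+\dim\mathcal E_g-e_g-f_g.$$
   Context: A full rank translation group on $\mathbb R^d$ is a set $\mathcal T=\{T_k:k\in\mathbb Z^d\}$ of translations with $T_{k+l}=T_kT_l$ whose period vectors $a_i=T_{\gamma_i}0$ ($\gamma_1,\dots,\gamma_d$ the standard basis) are linearly independent. $Z$ is the invertible matrix with $Z\gamma_i=a_i$, so $T_kx=x+Zk$. A crystal framework $\mathcal C=(F_v,F_e,\mathcal T)$ in $\mathbb R^d$, with motif $\mathcal M=(F_v,F_e)$, is a countable bar-joint framework (framework points in $\mathbb R^d$ together with framework edges, which are line segments of positive length joining certain pairs of framework points) whose framework points are $p_{\kappa,k}=T_kp_{\kappa,0}$, $1\le\kappa\le t$, $k\in\mathbb Z^d$, such that $F_v=\{p_{\kappa,0}\}$, $F_e$ is a finite set of framework edges, the set of framework points is the disjoint union of the $T_k(F_v)$ and the set of framework edges is the disjoint union of the $T_k(F_e)$. A motif edge is written $e=[p_{\kappa,l},p_{\tau,l'}]$ with edge vector $v_e=p_{\kappa,l}-p_{\tau,l'}$ and exponent $\delta(e)=l'-l=(\delta_1,\dots,\delta_d)$. The matrix $R(\mathcal M,\mathbb R^{d^2})$ is the $|F_e|\times(d|F_v|+d^2)$ matrix whose row for $e$ has $v_e$ in the $d$ columns for $\kappa$, $-v_e$ in the $d$ columns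 for $\tau$ (zero in these columns if $\kappa=\tau$), zeros in the other vertex columns, and $(\delta_1v_e,\dots,\delta_dv_e)$ in the last $d^2$ columns. For a linear space $\mathcal E$ of $d\times d$ matrices, $R(\mathcal M,\mathcal E):\mathbb R^{d|F_v|}\oplus\mathcal E\to\mathbb R^{|F_e|}$ is $(u,A)\mapsto R(\mathcal M,\mathbb R^{d^2})(u,AZ)$, with $AZ$ written as its $d$ columns in order. A pair $(u,A)$ represents the velocity vector $\tilde u_{\kappa,k}=u_\kappa-AZk$ on framework points. The space group $\mathcal G(\mathcal C)$ is the group of isometries $T_g$ of $\mathbb R^d$ mapping $\mathcal C$ to itself, viewed abstractly; it acts on vertex labels by $p_{g\cdot(\kappa,k)}=T_g(p_{\kappa,k})$ and correspondingly on edges. The element $g$ is semiseparable if there is an induced action $\kappa\mapsto g\cdot\kappa$ on motif vertices with $g\cdot(\kappa,k)=(g\cdot\kappa,k')$, where $k'$ may depend on $g,\kappa,k$ (semiseparability is a standing assumption). It is separable if moreover $g\cdot(\kappa,k)=(g\cdot\kappa,g\cdot k)$ for an action of the group generated by $g$ on $\mathbb Z^d\cong\mathcal T$ by group automorphisms, so that each $T_gp_{\kappa,0}$ has the form $p_{\kappa',0}$. It acts on $F_v$ if $T_g$ permutes the set $F_v=\{p_{\kappa,0}\}$. In either case the origin of $\mathbb R^d$ is taken so that $T_g$ is an orthogonal linear transformation. Put $\pi_v(g)(u,A)=(\mu_v(g)u,\ T_gAT_g^{-1})$ on $\mathbb R^{d|F_v|}\oplus M_d(\mathbb R)$, where $\mu_v(g)=\nu_n(g)\otimes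 T_g$, i.e. $(\mu_v(g)u)_\kappa=T_gu_{g^{-1}\cdot\kappa}$ ($\nu_n$ being the vertex class permutation representation on $\mathbb R^{|F_v|}$). Let $\pi_e(g)$ be the permutation transformation $(\pi_e(g)w)_f=w_{g^{-1}\cdot f}$ of $\mathbb R^{|F_e|}$, $g$ acting on $F_e$ identified with the $\mathcal T$-translation classes of edges. Definitions: $\mathcal F_g$ is the space of vectors in $\mathbb R^{d|F_v|}$ fixed by $\mu_v(g)$; $\mathcal E_g$ is the space of $d\times d$ real matrices commuting with $T_g$; $\mathcal H_v^g=\mathcal F_g\oplus\mathcal E_g$ is the space of vectors fixed by $\pi_v(g)$; $\mathcal H_e^g$ is the space of vectors in $\mathbb R^{|F_e|}$ fixed by $\pi_e(g)$, and $e_g=\dim\mathcal H_e^g$ is the number of orbits in $F_e$ under $g$. $\mathcal H_{\rm fl}^g=\mathcal H_v^g\cap\ker R(\mathcal M,\mathcal E_g)$ is the space of $\pi_v(g)$-invariant affinely periodic infinitesimal flexes; $\mathcal H_{\rm rig}^g$ is the space of those $(u,A)\in\mathcal H_v^g$ for which $\tilde u$ is an infinitesimal rigid motion ($\tilde u_{\kappa,k}=c+Sp_{\kappa,k}$, $c\in\mathbb R^d$, $S$ skew-symmetric), $f_g=\dim\mathcal H_{\rm rig}^g$; $\mathcal H_{\rm mech}^g=\mathcal H_{\rm fl}^g\ominus\mathcal H_{\rm rig}^g$, $m_g=\dim\mathcal H_{\rm mech}^g$; $\mathcal H_{\rm str}^g$ is the space of $\pi_e(g)$-invariant periodic infinitesimal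 self-stresses, i.e. vectors in $\mathcal H_e^g$ orthogonal to the range of $R(\mathcal M,\mathcal E_g)$, and $s_g=\dim\mathcal H_{\rm str}^g$. *)

(* Defs.v *)
From mathcomp Require Import all_boot all_order all_fingroup all_algebra.
From mathcomp Require Import boolp classical_sets reals.

Set Implicit Arguments.
Unset Strict Implicit.
Unset Printing Implicit Defensive.
Import Order.TTheory GRing.Theory Num.Theory.
Local Open Scope classical_set_scope.
Local Open Scope ring_scope.

(* The {vspace V} whose elements are those of S.  It is the junk value 0 when S
   is not closed under linear combinations, see [mem_subspace]. *)
Definition subspace (R : fieldType) (V : vectType R) (S : set V) : {vspace V} :=
  xget 0%VS [set U : {vspace V} | forall x, x \in U <-> S x].

Lemma mem_subspace (R : fieldType) (V : vectType R) (S : set V) :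
    S 0 -> (forall (a : R) (x y : V), S x -> S y -> S (a *: x + y)) ->
  forall x, x \in subspace S <-> S x.
Proof.
move=> S0 Slin; rewrite /subspace.
suff [U SU] : exists U : {vspace V}, forall x, x \in U <-> S x.
  by apply: (xgetI (P := [set U : {vspace V} | forall x, x \in U <-> S x]) _ SU).
pose P n := `[< exists U : {vspace V}, (forall x, x \in U -> S x) /\ \dim U = n >].
have exP : exists n, P n.
  exists 0%N; apply/asboolP; exists 0%VS; split; last exact: dimv0.
  by move=> x; rewrite memv0 => /eqP ->.
have leP n : P n -> (n <= \dim {: V})%N.
  by move=> /asboolP[U [_ <-]]; apply: dimvS; apply: subvf.
case: (ex_maxnP exP leP) => m /asboolP[U [US dimU]] maxm.
exists U => x; split=> [/US //|Sx].
have /maxm : P (\dim (<[x]> + U)%VS).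
  apply/asboolP; exists (<[x]> + U)%VS; split=> // y /memv_addP[_ /vlineP[a ->]].
  by move=> [u /US Su ->]; apply: Slin.
rewrite -dimU => le_dim.
have /eqP -> : U == (<[x]> + U)%VS by rewrite eqEdim addvSr le_dim.
by apply: (subvP (addvSl _ _)); apply: memv_line.
Qed.

(* The Euclidean inner product of matrices (in particular of column vectors):
   the library's norm on matrices is the sup norm. *)
Definition dotm (R : realType) m n (A B : 'M[R]_(m, n)) : R := \tr (A^T *m B).

Definition enorm (R : realType) d (x : 'cV[R]_d) : R := Num.sqrt (dotm x x).

Definition segment (R : realType) d (x y : 'cV[R]_d) : set 'cV[R]_d :=
  [set (1 - s) *: x + s *: y | s in [set s : R | 0 <= s <= 1]].

Definition intcol (R : realType) d (k : 'cV[int]_d) : 'cV[R]_d := map_mx intr k.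

(* A label (kappa, k) stands for the framework point p_{kappa,k}. *)
Definition label (d t : nat) := ('I_t * 'cV[int]_d)%type.

Definition point_at (R : realType) d t (Z : 'M[R]_d) (p : 'I_t -> 'cV[R]_d)
  (a : label d t) : 'cV[R]_d := p a.1 + Z *m intcol R a.2.

(* The framework edge T_k e of the motif edge e = [p_a, p_b], as a subset of
   R^d. *)
Definition edge_at (R : realType) d t n (Z : 'M[R]_d) (p : 'I_t -> 'cV[R]_d)
    (a b : 'I_n -> label d t) (ek : 'I_n * 'cV[int]_d) : set 'cV[R]_d :=
  segment (point_at Z p ((a ek.1).1, (a ek.1).2 + ek.2))
          (point_at Z p ((b ek.1).1, (b ek.1).2 + ek.2)).

(* A crystal framework in R^d with t motif vertices and n motif edges.  The two
   injectivity fields say that the sets of framework points and of framework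
   edges are the disjoint unions of the translates of the motif sets. *)
Record crystal_framework (R : realType) (d t n : nat) := CrystalFramework {
  period : 'M[R]_d;
  motif_point : 'I_t -> 'cV[R]_d;
  edge_src : 'I_n -> label d t;
  edge_tgt : 'I_n -> label d t;
  period_unit : period \in unitmx;
  point_at_inj : injective (point_at period motif_point);
  edge_pos_length : forall e, point_at period motif_point (edge_src e)
                              <> point_at period motif_point (edge_tgt e);
  edge_at_inj : injective (edge_at period motif_point edge_src edge_tgt)
}.

Section Crystal.
Variables (R : realType) (d t n : nat) (C : crystal_framework R d t n).

Local Notation Z := (period C).

Definition fpoint : label d t -> 'cV[R]_d := point_at Z (motif_point C).

Definition fedge : 'I_n * 'cV[int]_d -> set 'cV[R]_d :=
  edge_at Z (motif_point C) (edge_src C) (edge_tgt C).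

Definition motif_vertices : set 'cV[R]_d := range (fun i => fpoint (i, 0)).

Definition edge_vector (e : 'I_n) : 'cV[R]_d :=
  fpoint (edge_src C e) - fpoint (edge_tgt C e).

Definition exponent (e : 'I_n) : 'cV[int]_d :=
  (edge_tgt C e).2 - (edge_src C e).2.

(* The row of R(M, R^{d^2}) for e: the entries of the i-th row of the first
   matrix sit in the d columns of vertex i, those of the j-th row of the second
   one in the j-th group of d columns among the last d^2. *)
Definition rigidity_row (e : 'I_n) : 'rV[R]_(t * d + d * d) :=
  row_mx
    (mxvec (\matrix_(i < t) (((i == (edge_src C e).1)%:R
                              - (i == (edge_tgt C e).1)%:R)
                             *: (edge_vector e)^T)))
    (mxvec (\matrix_(j < d) ((exponent e j 0)%:~R *: (edge_vector e)^T))).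

Definition rigidity_matrix : 'M[R]_(n, t * d + d * d) :=
  \matrix_(e < n) rigidity_row e.

(* R^{d|F_v|} (+) M_d(R), where u in R^{d|F_v|} is the d x t matrix whose
   columns are the vectors u_kappa. *)
Definition vel := ('M[R]_(d, t) * 'M[R]_d)%type.

(* As mxvec lists entries row by row, mxvec X^T lists the columns of X. *)
Definition rigidity_map (x : vel) : 'cV[R]_n :=
  rigidity_matrix *m (row_mx (mxvec x.1^T) (mxvec (x.2 *m Z)^T))^T.

Definition vel_dom (E : {vspace 'M[R]_d}) : set vel := [set x | x.2 \in E].

Definition velocity (x : vel) (a : label d t) : 'cV[R]_d :=
  col a.1 x.1 - x.2 *m (Z *m intcol R a.2).

Definition rigid_motion (v : label d t -> 'cV[R]_d) : Prop :=
  exists (c : 'cV[R]_d) (S : 'M[R]_d),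
    S^T = - S /\ forall a, v a = c + S *m fpoint a.

Definition vel_dot (x y : vel) : R := dotm x.1 y.1 + dotm x.2 y.2.

Definition space_group : set ('cV[R]_d -> 'cV[R]_d) :=
  [set g | [/\ forall x y, enorm (g x - g y) = enorm (x - y),
               g @` range fpoint = range fpoint &
               [set g @` e | e in range fedge] = range fedge]].

Section Symmetry.
Variable g : 'cV[R]_d -> 'cV[R]_d.

(* The action (kappa, k) |-> g . (kappa, k) on labels; the label is unique. *)
Definition label_act (a : label d t) : label d t :=
  xget a [set b | fpoint b = g (fpoint a)].

Definition semiseparable : Prop :=
  exists s : {perm 'I_t}, forall i k, (label_act (i, k)).1 = s i.

(* An action of the group generated by g is given by the automorphism by which
   g acts. *)
Definition separable : Prop :=
  exists (s : {perm 'I_t}) (phi : {additive 'cV[int]_d -> 'cV[int]_d}),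
    bijective phi /\ forall i k, label_act (i, k) = (s i, phi k).

Definition acts_on_motif_vertices : Prop :=
  g @` motif_vertices = motif_vertices.

(* The induced actions on motif vertices (for g semiseparable) and on
   T-translation classes of edges, the latter indexed by motif edges. *)
Definition vertex_act (i : 'I_t) : 'I_t := (label_act (i, 0)).1.

Definition edge_act (e : 'I_n) : 'I_n :=
  xget e [set f | exists k, g @` fedge (e, 0) = fedge (f, k)].

(* The matrix of the linear part x |-> g x - g 0.  When g fixes a point this is
   the matrix of g for every choice of origin at a fixed point; as no space
   below depends on the origin, the origin need not be moved there. *)
Definition lin_part : 'M[R]_d := \matrix_(i, j) (g (delta_mx j 0) - g 0) i 0.

(* [finv f] is the inverse of an injective self-map f of a finite type. *)
Definition mu_v (u : 'M[R]_(d, t)) : 'M[R]_(d, t) :=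
  \matrix_(j, i) (lin_part *m col (finv vertex_act i) u) j 0.

Definition pi_v (x : vel) : vel :=
  (mu_v x.1, lin_part *m x.2 *m invmx lin_part).

Definition pi_e (w : 'cV[R]_n) : 'cV[R]_n :=
  \col_f w (finv edge_act f) 0.

Definition F_space : {vspace 'M[R]_(d, t)} := subspace [set u | mu_v u = u].

Definition E_space : {vspace 'M[R]_d} :=
  subspace [set A | A *m lin_part = lin_part *m A].

Definition Hv : {vspace vel} := subspace [set x | pi_v x = x].

Definition He : {vspace 'cV[R]_n} := subspace [set w | pi_e w = w].

Definition Hfl : {vspace vel} :=
  subspace [set x | [/\ x \in Hv, vel_dom E_space x & rigidity_map x = 0]].

Definition Hrig : {vspace vel} :=
  subspace [set x | x \in Hv /\ rigid_motion (velocity x)].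

Definition Hmech : {vspace vel} :=
  subspace [set x | x \in Hfl /\ forall y, y \in Hrig -> vel_dot x y = 0].

Definition Hstr : {vspace 'cV[R]_n} :=
  subspace [set w | w \in He /\
    forall x, vel_dom E_space x -> dotm w (rigidity_map x) = 0].

Definition e_dim : nat := \dim He.
Definition f_dim : nat := \dim Hrig.
Definition m_dim : nat := \dim Hmech.
Definition s_dim : nat := \dim Hstr.

(* Each set used above is a linear subspace, so that [subspace] is not junk. *)

Lemma dotm_linearr p q (w x y : 'M[R]_(p, q)) (a : R) :
  dotm w (a *: x + y) = a * dotm w x + dotm w y.
Proof. by rewrite /dotm mulmxDr -scalemxAr mxtraceD mxtraceZ. Qed.

Lemma dotmC p q (w x : 'M[R]_(p, q)) : dotm w x = dotm x w.
Proof. by rewrite /dotm -mxtrace_tr trmx_mul trmxK. Qed.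

Lemma dot0m p q (w : 'M[R]_(p, q)) : dotm 0 w = 0.
Proof. by rewrite /dotm trmx0 mul0mx mxtrace0. Qed.

Let lin0 (V W : lmodType R) (f : V -> W) :
  (forall a x y, f (a *: x + y) = a *: f x + f y) -> f 0 = 0.
Proof.
by move=> H; have := H (-1) 0 0; rewrite scaler0 addr0 scaleN1r addNr.
Qed.

Lemma mu_v_linear (a : R) (x y : 'M[R]_(d, t)) :
  mu_v (a *: x + y) = a *: mu_v x + mu_v y.
Proof.
by apply/matrixP => i j; rewrite /mu_v mxE linearP mulmxDr -scalemxAr !mxE.
Qed.

Lemma pi_v_linear (a : R) (x y : vel) :
  pi_v (a *: x + y) = a *: pi_v x + pi_v y.
Proof.
by rewrite /pi_v /= mu_v_linear mulmxDr -scalemxAr mulmxDl -scalemxAl.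
Qed.

Lemma pi_e_linear (a : R) (x y : 'cV[R]_n) :
  pi_e (a *: x + y) = a *: pi_e x + pi_e y.
Proof. by apply/matrixP => i j; rewrite !mxE. Qed.

Lemma rigidity_map_linear (a : R) (x y : vel) :
  rigidity_map (a *: x + y) = a *: rigidity_map x + rigidity_map y.
Proof.
rewrite /rigidity_map /= linearP mulmxDl -scalemxAl !linearP /= -add_row_mx.
by rewrite -scale_row_mx linearP /= mulmxDr -scalemxAr.
Qed.

Lemma mem_F_space u : u \in F_space <-> mu_v u = u.
Proof.
apply: mem_subspace => /=; first exact: lin0 mu_v_linear.
by move=> a x y Hx Hy; rewrite mu_v_linear Hx Hy.
Qed.

Lemma mem_E_space A : A \in E_space <-> A *m lin_part = lin_part *m A.
Proof.
apply: mem_subspace => /=; first by rewrite mulmx0 mul0mx.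
by move=> a x y Hx Hy; rewrite mulmxDl mulmxDr -scalemxAl -scalemxAr Hx Hy.
Qed.

Lemma mem_Hv x : x \in Hv <-> pi_v x = x.
Proof.
apply: mem_subspace => /=; first exact: lin0 pi_v_linear.
by move=> a u v Hu Hv; rewrite pi_v_linear Hu Hv.
Qed.

Lemma mem_He w : w \in He <-> pi_e w = w.
Proof.
apply: mem_subspace => /=; first exact: lin0 pi_e_linear.
by move=> a u v Hu Hv; rewrite pi_e_linear Hu Hv.
Qed.

Lemma mem_Hfl x :
  x \in Hfl <-> [/\ x \in Hv, vel_dom E_space x & rigidity_map x = 0].
Proof.
apply: mem_subspace => /=.
  by rewrite /vel_dom /= !mem0v; split=> //; apply: lin0 rigidity_map_linear.
move=> a u v [h1 h2 h3] [k1 k2 k3]; split.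
- exact: memvD (memvZ _ h1) k1.
- exact: memvD (memvZ _ h2) k2.
- by rewrite rigidity_map_linear h3 k3 scaler0 addr0.
Qed.

Lemma mem_Hrig x : x \in Hrig <-> x \in Hv /\ rigid_motion (velocity x).
Proof.
apply: mem_subspace => /=.
  rewrite mem0v; split=> //; exists 0, 0; rewrite trmx0 oppr0; split=> // a.
  by rewrite /velocity /= linear0 !mul0mx subr0 addr0.
move=> a u v [h1 [c1 [S1 [s1 e1]]]] [k1 [c2 [S2 [s2 e2]]]].
split; first exact: memvD (memvZ _ h1) k1.
exists (a *: c1 + c2), (a *: S1 + S2); split.
  by rewrite linearP /= s1 s2 scalerN opprD.
move=> b; have := e1 b; have := e2 b; rewrite /velocity /= => E2 E1.
rewrite linearP /= !mulmxDl -!scalemxAl.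
by rewrite opprD addrACA -scalerBr E1 E2 scalerDr addrACA.
Qed.

Lemma mem_Hmech x :
  x \in Hmech <-> x \in Hfl /\ forall y, y \in Hrig -> vel_dot x y = 0.
Proof.
apply: mem_subspace => /=.
  by rewrite mem0v; split=> // y _; rewrite /vel_dot /= !dot0m addr0.
move=> a u v [h1 h2] [k1 k2]; split; first exact: memvD (memvZ _ h1) k1.
move=> y yr; have := h2 y yr; have := k2 y yr; rewrite /vel_dot /=.
rewrite !(dotmC _ y.1) !(dotmC _ y.2) !dotm_linearr addrACA -mulrDr => -> ->.
by rewrite mulr0 addr0.
Qed.

Lemma mem_Hstr w :
  w \in Hstr <-> w \in He /\
    forall x, vel_dom E_space x -> dotm w (rigidity_map x) = 0.
Proof.
apply: mem_subspace => /=.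
  by rewrite mem0v; split=> // y _; rewrite dot0m.
move=> a u v [h1 h2] [k1 k2]; split; first exact: memvD (memvZ _ h1) k1.
move=> y yr; rewrite dotmC dotm_linearr !(dotmC (rigidity_map y)).
by rewrite h2 // k2 // mulr0 addr0.
Qed.

End Symmetry.
End Crystal.

(* Main.v *)
Require Import Defs.
From HB Require Import structures.
From mathcomp Require Import all_boot all_order perm all_algebra.
From mathcomp Require Import ring lra zify boolp classical_sets reals.
Import Order.TTheory GRing.Theory Num.Theory.
Local Open Scope ring_scope.

(** The theorem is the rank-nullity theorem for the rigidity map restricted to
    [Hv], the space of symmetric velocities, together with an identification of
    its cokernel.  Write r for the rank of this restriction.

    The kernel is [Hfl], which is the orthogonal sum of [Hrig] and [Hmech]; so
    m + f = dim Hv - r.  Moreover Hv = F (+) E.  The inclusion of [Hrig] in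
    [Hfl] needs that rigid motions strain no edge: z . S z = 0 for S skew.

    For the cokernel, the rigidity map intertwines [pi_v] and [pi_e]
    ([rigidity_map_pi_v]).  Hence it sends [Hv] into [He], and the complement of
    the image in [He] has dimension e - r.  This complement is [Hstr], although
    a stress in [Hstr] has to be orthogonal to the image of all of
    R^(d|F_v|) (+) E and not only of [Hv] ([Hstr_orthogonal]).  Indeed if w is
    fixed by [pi_e], then u |-> <w, R(u, 0)> is given by a vector q which is
    fixed by the orthogonal transformation [mu_v]; so (q, 0) is in [Hv], and
    |q|^2 = <w, R(q, 0)> = 0.  Thus s = e - r, and the formula follows by
    subtraction.

    The intertwining is obtained without manipulating the rigidity matrix: its
    entry at an edge is the strain (p_a - p_b) . (v_a - v_b) between the end
    labels a and b ([rigidity_map_strain]).  The strain is symmetric in a and b,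
    invariant under translations of the pair, and preserved when g acts on
    labels and velocities simultaneously ([strain_pi_v]).  So it only depends on
    the translation class of the edge, and g permutes these classes.

    Separability of g and invariance of the motif vertices under g enter through
    the same consequence, that g sends p_(i,0) to some p_(j,0)
    ([label_act_motif_vertex]).  With semiseparability this makes the linear
    part of g preserve the period lattice compatibly with the labels
    ([period_label_act]). *)

(** * The Euclidean inner product *)

Section Dot.
Context {R : realType}.

Lemma dotmE m n (A B : 'M[R]_(m, n)) :
  dotm A B = \sum_(j < n) \sum_(i < m) A i j * B i j.
Proof.
rewrite /dotm /mxtrace; apply: eq_bigr => j _.
by rewrite mxE; apply: eq_bigr => i _; rewrite mxE.
Qed.

Lemma dotmDr m n (A B C : 'M[R]_(m, n)) : dotm A (B + C) = dotm A B + dotm A C.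
Proof. by rewrite -[B]scale1r dotm_linearr mul1r scale1r. Qed.

Lemma dotm0r m n (A : 'M[R]_(m, n)) : dotm A 0 = 0.
Proof. by rewrite dotmC dot0m. Qed.

Lemma dotmZr m n a (A B : 'M[R]_(m, n)) : dotm A (a *: B) = a * dotm A B.
Proof. by rewrite -[a *: B]addr0 dotm_linearr dotm0r addr0. Qed.

Lemma dotmNr m n (A B : 'M[R]_(m, n)) : dotm A (- B) = - dotm A B.
Proof. by rewrite -scaleN1r dotmZr mulN1r. Qed.

Lemma dotmDl m n (A B C : 'M[R]_(m, n)) : dotm (A + B) C = dotm A C + dotm B C.
Proof. by rewrite dotmC dotmDr !(dotmC C). Qed.

Lemma dotmZl m n a (A B : 'M[R]_(m, n)) : dotm (a *: A) B = a * dotm A B.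
Proof. by rewrite dotmC dotmZr (dotmC B). Qed.

Lemma dotmNl m n (A B : 'M[R]_(m, n)) : dotm (- A) B = - dotm A B.
Proof. by rewrite dotmC dotmNr (dotmC B). Qed.

Definition dotm_bilinear := (dotmDl, dotmDr, dotmNl, dotmNr, dotmZl, dotmZr).

Lemma dotm_ge0 m n (A : 'M[R]_(m, n)) : 0 <= dotm A A.
Proof.
rewrite dotmE; apply: sumr_ge0 => j _; apply: sumr_ge0 => i _.
by rewrite -expr2 sqr_ge0.
Qed.

Lemma dotm_eq0 m n (A : 'M[R]_(m, n)) : dotm A A = 0 -> A = 0.
Proof.
rewrite dotmE => /eqP; rewrite psumr_eq0; last first.
  by move=> j _; apply: sumr_ge0 => i _; rewrite -expr2 sqr_ge0.
move=> /allP A0; apply/matrixP => i j; rewrite mxE.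
have := A0 j (mem_index_enum j); rewrite /= psumr_eq0; last first.
  by move=> k _; rewrite -expr2 sqr_ge0.
move=> /allP /(_ i (mem_index_enum i)) /=.
by rewrite mulf_eq0 orbb => /eqP.
Qed.

Lemma dotm_cols m n (A B : 'M[R]_(m, n)) :
  dotm A B = \sum_(j < n) dotm (col j A) (col j B).
Proof.
rewrite dotmE; apply: eq_bigr => j _; rewrite dotmE big_ord1.
by apply: eq_bigr => i _; rewrite !mxE.
Qed.

Lemma dotm_delta d (x : 'cV[R]_d) i : dotm (delta_mx i 0) x = x i 0.
Proof.
rewrite dotmE big_ord1 (bigD1 i) //= big1 => [|j ji].
  by rewrite mxE !eqxx mul1r addr0.
by rewrite mxE (negbTE ji) mul0r.
Qed.

Lemma dotm_mul_orthogonal d n (T : 'M[R]_d) (A B : 'M[R]_(d, n)) :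
  T^T *m T = 1%:M -> dotm (T *m A) (T *m B) = dotm A B.
Proof. by move=> TT; rewrite /dotm trmx_mul mulmxA -(mulmxA A^T) TT mulmx1. Qed.

Lemma dotm_skew d (S : 'M[R]_d) (x : 'cV[R]_d) :
  S^T = - S -> dotm x (S *m x) = 0.
Proof.
move=> skewS; have : dotm x (S *m x) = - dotm x (S *m x).
  rewrite -dotmNr -mulNmx -skewS [LHS]dotmC.
  by rewrite /dotm trmx_mul mulmxA.
by move/eqP; rewrite -addr_eq0 -mulr2n mulrn_eq0 => /eqP.
Qed.

Lemma dotm_mxvec m n (A B : 'M[R]_(m, n)) :
  (mxvec A *m (mxvec B)^T) 0 0 = dotm A B.
Proof.
rewrite mxE (reindex _ (curry_mxvec_bij m n)) /= dotmE exchange_big /=.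
rewrite pair_big /=; apply: eq_bigr => -[i j] _ /=.
by rewrite [(mxvec B)^T _ _]mxE !mxvecE.
Qed.

(** Both blocks of a row of the rigidity matrix have this form: multiples of one
    edge vector, paired with the list of the columns of a matrix. *)
Lemma dotm_scaled_rows m d (c : 'I_m -> R) (v : 'cV[R]_d) (X : 'M[R]_(d, m)) :
  dotm (\matrix_(i < m) (c i *: v^T)) X^T = dotm v (X *m \col_i c i).
Proof.
have -> : \matrix_(i < m) (c i *: v^T) = (\col_i c i) *m v^T.
  by apply/matrixP => i j; rewrite !mxE big_ord1 !mxE.
rewrite [RHS]dotmC /dotm (trmx_mul X) (trmx_mul _ v^T) trmxK -mulmxA.
exact: mxtrace_mulC.
Qed.

Lemma dotm_riesz m n (f : 'M[R]_(m, n) -> R) :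
    (forall a x y, f (a *: x + y) = a * f x + f y) ->
  exists q, forall x, f x = dotm q x.
Proof.
move=> lf; exists (\matrix_(i, j) f (delta_mx i j)) => x.
have f0 : f 0 = 0.
  by have := lf (-1) 0 0; rewrite scaler0 addr0 mulN1r addNr.
have fD x1 x2 : f (x1 + x2) = f x1 + f x2.
  by rewrite -[x1]scale1r lf mul1r scale1r.
rewrite {1}(matrix_sum_delta x) (big_morph f fD f0) dotmE exchange_big /=.
apply: eq_bigr => i _; rewrite (big_morph f fD f0); apply: eq_bigr => j _.
by rewrite -[_ *: _]addr0 lf f0 addr0 mxE mulrC.
Qed.

End Dot.

(** * Linear algebra *)

Lemma linear_hom (K : fieldType) (V W : vectType K) (f : V -> W) :
    (forall a x y, f (a *: x + y) = a *: f x + f y) ->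
  exists F : 'Hom(V, W), F =1 f.
Proof.
move=> lf; pose mixin := GRing.isLinear.Build K V W *:%R f lf.
pose F : {linear V -> W} := HB.pack f mixin.
by exists (linfun F) => x; rewrite lfunE.
Qed.

(** The pairings with a basis of U define a linear map to K^(dim U).  Its kernel
    in W is S, and it is already onto when restricted to U, where it is
    injective because b is anisotropic. *)
Lemma dim_orthogonal_complement (K : fieldType) (V : vectType K)
    (b : V -> V -> K) (W U S : {vspace V}) :
    (forall y a x1 x2, b (a *: x1 + x2) y = a * b x1 y + b x2 y) ->
    (forall x y, b x y = b y x) -> (forall x, b x x = 0 -> x = 0) ->
    (U <= W)%VS ->
    (forall x, x \in S <-> x \in W /\ forall y, y \in U -> b x y = 0) ->
  (\dim S + \dim U = \dim W)%N.
Proof.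
move=> bl bC b0 UW SP.
have [F Fval] : exists F : 'Hom(V, 'rV[K]_(\dim U)),
    F =1 fun x => \row_i b x (vbasis U)`_i.
  by apply: linear_hom => a x y; apply/rowP => i; rewrite !mxE bl.
have b0r x : b x 0 = 0.
  by have := bl x (-1) 0 0; rewrite scaler0 addr0 mulN1r addNr bC.
have bDr x y1 y2 : b x (y1 + y2) = b x y1 + b x y2.
  by rewrite bC -[y1]scale1r bl mul1r scale1r !(bC x).
have kerF x : x \in lker F <-> forall y, y \in U -> b x y = 0.
  rewrite memv_ker; split=> [/eqP Fx0 y yU|xU].
    rewrite (coord_vbasis yU) (big_morph (b x) (bDr x) (b0r x)) big1 // => i _.
    rewrite bC -[_ *: _]addr0 bl !(bC _ x) b0r addr0.
    have := congr1 (fun r : 'rV[K]_(\dim U) => r 0 i) Fx0.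
    by rewrite Fval !mxE => ->; rewrite mulr0.
  apply/eqP/rowP => i; rewrite Fval !mxE; apply: xU.
  by apply: vbasis_mem; apply: mem_nth; rewrite size_tuple.
have dimFU : \dim (F @: U) = \dim U.
  apply: limg_dim_eq; apply/eqP; rewrite -subv0; apply/subvP => x.
  rewrite memv_cap memv0 => /andP[xU /kerF xperp].
  by apply/eqP/b0/xperp.
rewrite -(limg_ker_dim F W); congr (\dim _ + _)%N.
  apply/vspaceP => x; rewrite memv_cap; apply/idP/andP.
    by move=> /SP[-> /kerF ->].
  by move=> [xW /kerF xperp]; apply/SP.
apply/eqP; rewrite eqn_leq -{1}dimFU (dimvS (limgS F UW)) /=.
apply: leq_trans (dimvS (subvf _)) _.
by rewrite dimvf dim_matrix; apply: eq_leq; apply: mul1n.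
Qed.

(** * Isometries are affine with orthogonal linear part *)

(** The squared norm of h (a x + y) - a h x - h y expands into inner products of
    values of h, so it is unchanged when h is replaced by the identity. *)
Lemma dot_preserving_linear {R : realType} {d : nat}
    (h : 'cV[R]_d -> 'cV[R]_d) :
    (forall x y, dotm (h x) (h y) = dotm x y) ->
  forall a x y, h (a *: x + y) = a *: h x + h y.
Proof.
move=> hdot a x y; apply/eqP; rewrite -subr_eq0; apply/eqP/dotm_eq0.
rewrite !dotm_bilinear !hdot !dotm_bilinear (dotmC y x); ring.
Qed.

Lemma dotm_sub_sqr {R : realType} {d : nat} (x y : 'cV[R]_d) :
  dotm (x - y) (x - y) = dotm x x + dotm y y - dotm x y *+ 2.
Proof. rewrite !dotm_bilinear (dotmC y x); ring. Qed.

Section Isometry.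
Context {R : realType} {d : nat}.
Variable g : 'cV[R]_d -> 'cV[R]_d.
Hypothesis g_iso : forall x y, enorm (g x - g y) = enorm (x - y).

(** Polarization, from the pairs (x, y), (x, 0) and (y, 0). *)
Lemma isometry_dot x y : dotm (g x - g 0) (g y - g 0) = dotm x y.
Proof.
have sq x1 y1 : dotm (g x1 - g y1) (g x1 - g y1) = dotm (x1 - y1) (x1 - y1).
  rewrite -[LHS]sqr_sqrtr ?dotm_ge0// -[RHS]sqr_sqrtr ?dotm_ge0//.
  by rewrite -!/(enorm _) g_iso.
have := sq x y; have := sq x 0; have := sq y 0; rewrite !subr0.
have -> : g x - g y = (g x - g 0) - (g y - g 0) by rewrite opprB addrA subrK.
rewrite (dotm_sub_sqr x) (dotm_sub_sqr (g x - g 0)) => -> -> /addrI /oppr_inj.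
by move/eqP; rewrite eqr_pMn2r // => /eqP.
Qed.

Lemma isometry_affine x : g x = g 0 + lin_part g *m x.
Proof.
pose h z := g z - g 0.
have hlin a x1 x2 : h (a *: x1 + x2) = a *: h x1 + h x2.
  by apply: dot_preserving_linear; apply: isometry_dot.
have h0 : h 0 = 0 by rewrite /h subrr.
have hD x1 x2 : h (x1 + x2) = h x1 + h x2.
  by have := hlin 1 x1 x2; rewrite !scale1r.
suff <- : h x = lin_part g *m x by rewrite /h subrKC.
rewrite {1}(matrix_sum_delta x) (big_morph h hD h0).
apply/colP => i; rewrite summxE mxE.
apply: eq_bigr => j _; rewrite big_ord1 -[_ *: _]addr0 hlin h0 addr0 !mxE.
by rewrite mulrC.
Qed.

Lemma isometry_orthogonal : (lin_part g)^T *m lin_part g = 1%:M.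
Proof.
apply/matrixP => i j.
have -> : ((lin_part g)^T *m lin_part g) i j =
    dotm (g (delta_mx i 0) - g 0) (g (delta_mx j 0) - g 0).
  by rewrite dotmE big_ord1 [LHS]mxE; apply: eq_bigr => k _; rewrite !mxE.
by rewrite isometry_dot dotm_delta !mxE eqxx andbT.
Qed.

End Isometry.

(** * Segments *)

Section Segment.
Context {R : realType} {d : nat}.
Implicit Types x y c : 'cV[R]_d.

Lemma segmentl x y : segment x y x.
Proof. by exists 0; rewrite /= ?lexx ?ler01// subr0 scale1r scale0r addr0. Qed.

Lemma segmentr x y : segment x y y.
Proof. by exists 1; rewrite /= ?lexx ?ler01// subrr scale1r scale0r add0r. Qed.

Lemma image_segment {f : 'cV[R]_d -> 'cV[R]_d} x y :
    (forall s, f ((1 - s) *: x + s *: y) = (1 - s) *: f x + s *: f y) ->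
  (f @` segment x y = segment (f x) (f y))%classic.
Proof.
move=> faff; apply/seteqP; split=> [_ [_ [s s01 <-] <-]|_ [s s01 <-]].
  by exists s; rewrite ?faff.
by exists ((1 - s) *: x + s *: y); [exists s|rewrite faff].
Qed.

Lemma image_segment_translation c x y :
  ((+%R^~ c) @` segment x y = segment (x + c) (y + c))%classic.
Proof.
apply: (@image_segment (+%R^~ c)) => s.
by rewrite !scalerDr addrACA -scalerDl subrK scale1r.
Qed.

(** Each segment contains the ends of the other.  If x and y have parameters s
    and r on the second one, and x' and y' have parameters a and b on the first,
    then y - x and y' - x' are multiples of one another with factors r - s and
    b - a in [-1, 1].  The product of the factors is 1, which forces r - s to be
    1 or -1, that is, {r, s} = {0, 1}. *)
Lemma segment_inj x y x' y' : x <> y -> segment x y = segment x' y' ->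
  (x = x' /\ y = y') \/ (x = y' /\ y = x').
Proof.
move=> xy eqs.
have [s /andP[s0 s1] xE] : segment x' y' x by rewrite -eqs; apply: segmentl.
have [r /andP[r0 r1] yE] : segment x' y' y by rewrite -eqs; apply: segmentr.
have [a /andP[a0 a1] xE'] : segment x y x' by rewrite eqs; apply: segmentl.
have [b /andP[b0 b1] yE'] : segment x y y' by rewrite eqs; apply: segmentr.
have D : y - x = (r - s) *: (y' - x').
  by rewrite -xE -yE; apply/colP => i; rewrite !mxE; ring.
have D' : y' - x' = (b - a) *: (y - x).
  by rewrite -xE' -yE'; apply/colP => i; rewrite !mxE; ring.
have rsba : (r - s) * (b - a) = 1.
  apply/eqP; rewrite -subr_eq0; apply/eqP.
  have : ((r - s) * (b - a) - 1) *: (y - x) = 0.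
    by rewrite scalerBl scale1r -scalerA -D' -D subrr.
  move/eqP; rewrite scaler_eq0 => /orP[/eqP //|].
  by rewrite subr_eq0 => /eqP/esym.
have [[rE sE]|[rE sE]] : (r = 1 /\ s = 0) \/ (r = 0 /\ s = 1).
- have [sr|rs] := lerP s r.
    by left; split; nra.
  by right; split; nra.
- by left; rewrite -xE -yE rE sE subrr subr0 !scale1r !scale0r addr0 add0r.
- by right; rewrite -xE -yE rE sE subrr subr0 !scale1r !scale0r addr0 add0r.
Qed.

End Segment.

Section Crystal.
Context {R : realType} {d t n : nat}.
Variable C : crystal_framework R d t n.
Local Notation Z := (period C).

(** * Strain *)

(** Half the rate of change of the squared distance between the points labelled
    a and b, under the velocity x. *)
Definition strain (x : vel R d t) (a b : label d t) : R :=
  dotm (fpoint C a - fpoint C b) (velocity C x a - velocity C x b).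

Lemma strainC x a b : strain x a b = strain x b a.
Proof.
by rewrite /strain -opprB -[_ - velocity _ _ b]opprB dotmNl dotmNr opprK.
Qed.

Lemma fpoint_translate i k l :
  fpoint C (i, l + k) = fpoint C (i, l) + Z *m intcol R k.
Proof. by rewrite /fpoint /point_at /intcol /= raddfD mulmxDr addrA. Qed.

Lemma velocity_translate x i k l :
  velocity C x (i, l + k) = velocity C x (i, l) - x.2 *m (Z *m intcol R k).
Proof.
by rewrite /velocity /intcol /= raddfD !mulmxDr opprD addrA.
Qed.

Lemma strain_translate x (a b : label d t) k :
  strain x (a.1, a.2 + k) (b.1, b.2 + k) = strain x a b.
Proof.
rewrite /strain !fpoint_translate !velocity_translate -!surjective_pairing.
by congr dotm; rewrite opprD addrACA ?opprK ?addNr ?subrr addr0.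
Qed.

(** The affine part contributes A Z (l' - l) to the velocity difference along an
    edge with end labels (_, l) and (_, l'), which is the pairing with the
    exponent in the last d^2 columns. *)
Lemma rigidity_map_strain x e :
  rigidity_map C x e 0 = strain x (edge_src C e) (edge_tgt C e).
Proof.
set a := edge_src C e; set b := edge_tgt C e.
have -> : rigidity_map C x e 0 =
    (rigidity_row C e *m (row_mx (mxvec x.1^T) (mxvec (x.2 *m Z)^T))^T) 0 0.
  by rewrite !mxE; apply: eq_bigr => j _; rewrite !mxE.
rewrite tr_row_mx mul_row_col mxE !dotm_mxvec !dotm_scaled_rows -dotmDr.
congr dotm.
have -> : \col_i ((i == a.1)%:R - (i == b.1)%:R) =
    delta_mx a.1 0 - delta_mx b.1 0 :> 'cV[R]_t.
  by apply/colP => i; rewrite !mxE !andbT.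
have -> : \col_i (exponent C e i 0)%:~R = intcol R b.2 - intcol R a.2.
  by apply/colP => i; rewrite !mxE rmorphB.
rewrite !mulmxBr -!colE /velocity !mulmxA opprB -!addrA; congr (_ + _).
by rewrite addrC [RHS]addrC -!addrA; congr (_ + _); rewrite addrC.
Qed.

Lemma rigid_motion_strain x a b :
  rigid_motion C (velocity C x) -> strain x a b = 0.
Proof.
move=> [c [S [skewS vE]]]; rewrite /strain !vE [c + _]addrC addrKA.
by rewrite -mulmxBr dotm_skew.
Qed.

Lemma fedge_segment (e : 'I_n) (k : 'cV[int]_d) :
  fedge C (e, k) = segment
    (fpoint C ((edge_src C e).1, (edge_src C e).2 + k))
    (fpoint C ((edge_tgt C e).1, (edge_tgt C e).2 + k)).
Proof. by []. Qed.

Lemma fedge_translate (e : 'I_n) (k l : 'cV[int]_d) :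
  fedge C (e, k + l) = ((+%R^~ (Z *m intcol R l)) @` fedge C (e, k))%classic.
Proof.
by rewrite !fedge_segment image_segment_translation -!fpoint_translate !addrA.
Qed.

(** * Action of a symmetry on points and edges *)

Section Symmetry.
Variable g : 'cV[R]_d -> 'cV[R]_d.
Hypothesis g_sym : space_group C g.
Local Notation T := (lin_part g).
Local Notation act := (label_act C g).

Let g_affine x : g x = g 0 + T *m x.
Proof. by case: g_sym => giso _ _; apply: isometry_affine. Qed.

Let T_orthogonal : T^T *m T = 1%:M.
Proof. by case: g_sym => giso _ _; apply: isometry_orthogonal. Qed.

(** The label of g p exists because g maps framework points to framework points,
    so the default value in [label_act] is not reached. *)
Lemma fpoint_label_act a : fpoint C (act a) = g (fpoint C a).
Proof.
apply: (@xgetPex _ a (fun b => fpoint C b = g (fpoint C a))).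
case: g_sym => _ gpts _.
have : (g @` range (fpoint C))%classic (g (fpoint C a)).
  by exists (fpoint C a) => //; exists a.
by rewrite gpts => -[b _ <-]; exists b.
Qed.

Lemma symmetry_sub x y : g x - g y = T *m (x - y).
Proof.
by rewrite (g_affine x) (g_affine y) mulmxBr [g 0 + _]addrC addrKA.
Qed.

Lemma image_segment_symmetry x y :
  (g @` segment x y = segment (g x) (g y))%classic.
Proof.
apply: image_segment => s.
rewrite (g_affine x) (g_affine y) g_affine mulmxDr -!scalemxAr !scalerDr.
by rewrite addrACA -scalerDl subrK scale1r.
Qed.

Lemma image_fedge_ends {e f : 'I_n} {k l : 'cV[int]_d} :
    (g @` fedge C (e, k))%classic = fedge C (f, l) ->
  let ea := act ((edge_src C e).1, (edge_src C e).2 + k) in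
  let eb := act ((edge_tgt C e).1, (edge_tgt C e).2 + k) in
  let fa := ((edge_src C f).1, (edge_src C f).2 + l) in
  let fb := ((edge_tgt C f).1, (edge_tgt C f).2 + l) in
  (ea = fa /\ eb = fb) \/ (ea = fb /\ eb = fa).
Proof.
rewrite !fedge_segment image_segment_symmetry -!fpoint_label_act => eqs /=.
have [|[/point_at_inj <- /point_at_inj <-]|[/point_at_inj <- /point_at_inj <-]]
  := segment_inj _ _ _ _ _ eqs; [|by left|by right].
rewrite !fpoint_label_act !fpoint_translate => /eqP.
rewrite -!surjective_pairing -subr_eq0 symmetry_sub opprD addrACA subrr addr0.
move=> /eqP Tv0; apply: (@edge_pos_length _ _ _ _ C e); apply/eqP.
rewrite -subr_eq0; apply/eqP.
by rewrite -[LHS]mul1mx -T_orthogonal -mulmxA [T *m _]Tv0 mulmx0.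
Qed.

(** * Separable symmetries *)

Section Separable.
Hypothesis g_semi : semiseparable C g.
Hypothesis g_sep : separable C g \/ acts_on_motif_vertices C g.

(** For a separable g this holds as an automorphism fixes 0; for g acting on the
    motif vertices, as the label of a point is unique. *)
Lemma label_act_motif_vertex i : (act (i, 0)).2 = 0.
Proof.
case: g_sep => [[s [phi [_ actE]]]|gmv]; first by rewrite actE /= raddf0.
have : (g @` motif_vertices C)%classic (g (fpoint C (i, 0))).
  by exists (fpoint C (i, 0)) => //; exists i.
rewrite gmv => -[j _]; rewrite -fpoint_label_act => /point_at_inj <- //.
Qed.

Lemma label_act_vertex i k : (act (i, k)).1 = vertex_act C g i.
Proof. by case: g_semi => s actE; rewrite /vertex_act !actE. Qed.

Lemma vertex_act_inj : injective (vertex_act C g).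
Proof.
case: g_semi => s actE i j; rewrite /vertex_act !actE; exact: perm_inj.
Qed.

(** The labels g . (i, k) and g . (i, 0) have the same vertex class, and the
    second one has translation part 0.  So the difference of their points, the
    image of Z k under the linear part of g, is a period. *)
Lemma period_label_act i k :
  Z *m intcol R (act (i, k)).2 = T *m (Z *m intcol R k).
Proof.
have := symmetry_sub (fpoint C (i, 0 + k)) (fpoint C (i, 0)).
rewrite {2}fpoint_translate [_ + Z *m _]addrC addrK add0r.
rewrite -!fpoint_label_act => <-.
rewrite [act (i, k)]surjective_pairing [act (i, 0)]surjective_pairing.
rewrite !label_act_vertex label_act_motif_vertex -[X in fpoint C (_, X)]add0r.
by rewrite fpoint_translate [_ + Z *m _]addrC addrK.
Qed.

(** As the linear part of g maps periods to periods, translates of an edge have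
    images in one translation class. *)
Lemma image_fedge0 {e f : 'I_n} {k l : 'cV[int]_d} :
    (g @` fedge C (e, k))%classic = fedge C (f, l) ->
  exists l', (g @` fedge C (e, 0))%classic = fedge C (f, l').
Proof.
move=> gek; pose m := (act ((edge_src C e).1, k)).2.
exists (l - m); rewrite fedge_translate -gek.
have -> : fedge C (e, 0) =
    ((+%R^~ (Z *m intcol R (- k))) @` fedge C (e, k))%classic.
  by rewrite -fedge_translate subrr.
rewrite [LHS]image_comp [RHS]image_comp; congr (image _ _).
apply/funext => x /=.
rewrite (g_affine x) g_affine mulmxDr addrA; congr (_ + _).
have intcolN (u : 'cV[int]_d) : intcol R (- u) = - intcol R u.
  by rewrite /intcol raddfN.
by rewrite !intcolN !mulmxN period_label_act.
Qed.

Lemma edge_act_image e :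
  exists k, (g @` fedge C (e, 0))%classic = fedge C (edge_act C g e, k).
Proof.
apply: (@xgetPex _ e
  (fun f => exists k, (g @` fedge C (e, 0))%classic = fedge C (f, k))).
case: g_sym => _ _ gedges.
have : ([set g @` e' | e' in range (fedge C)] (g @` fedge C (e, 0)))%classic.
  by exists (fedge C (e, 0)) => //; exists (e, 0).
by rewrite gedges => -[[f k] _ <-]; exists f, k.
Qed.

(** Surjectivity on translation classes comes from the surjectivity of g on
    framework edges; injectivity is then a matter of finiteness. *)
Lemma edge_act_surj f : exists e, edge_act C g e = f.
Proof.
case: g_sym => _ _ gedges.
have : range (fedge C) (fedge C (f, 0)) by exists (f, 0).
rewrite -gedges => -[_ [[e k] _ <-] /image_fedge0[l gef]]; exists e.
have [l' ge] := edge_act_image e.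
by move: gef; rewrite ge => /edge_at_inj[].
Qed.

Lemma edge_act_inj : injective (edge_act C g).
Proof.
have [h hK] := choice edge_act_surj.
exact: can_inj (canF_sym hK).
Qed.

(** * Equivariance of the rigidity map *)

(** The points and the velocities at labels a and g . a correspond under the
    linear part T of g: on the affine part, T A T^-1 (T Z k) = T (A Z k). *)
Lemma velocity_pi_v x i k :
  velocity C (pi_v C g x) (act (i, k)) = T *m velocity C x (i, k).
Proof.
rewrite /velocity period_label_act label_act_vertex mulmxBr /=.
have unitT : T \in unitmx by case: (mulmx1_unit T_orthogonal).
congr (_ - _); last by rewrite -!mulmxA (mulmxA (invmx T)) mulVmx // mul1mx.
apply/colP => j; rewrite /mu_v !mxE finv_f; last exact: vertex_act_inj.
by apply: eq_bigr => l _; rewrite !mxE.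
Qed.

Lemma strain_pi_v x a b :
  strain (pi_v C g x) (act a) (act b) = strain x a b.
Proof.
case: a b => [i k] [j l].
rewrite /strain !velocity_pi_v !fpoint_label_act symmetry_sub -mulmxBr.
exact: dotm_mul_orthogonal.
Qed.

Lemma rigidity_map_pi_v x :
  rigidity_map C (pi_v C g x) = pi_e C g (rigidity_map C x).
Proof.
apply/colP => f; rewrite [RHS]mxE.
set e := finv _ f.
have ef : edge_act C g e = f by apply: f_finv; apply: edge_act_inj.
(* The image of e is the translate of f by k, up to the order of its ends. *)
have [k ge] := edge_act_image e; rewrite ef in ge.
rewrite [LHS]rigidity_map_strain [RHS]rigidity_map_strain.
rewrite -[LHS](strain_translate _ _ _ k) -[RHS]strain_pi_v.
have := image_fedge_ends ge; rewrite !addr0 -!surjective_pairing /=.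
by case=> -[-> ->]; [reflexivity|apply: strainC].
Qed.

(** * Symmetric velocities and stresses *)

(** [mu_v] permutes the columns and applies an orthogonal matrix to each. *)
Lemma mu_v_dot u v : dotm (mu_v C g u) (mu_v C g v) = dotm u v.
Proof.
have colmu i w : col i (mu_v C g w) = T *m col (finv (vertex_act C g) i) w.
  by apply/colP => j; rewrite !mxE; apply: eq_bigr => l _; rewrite !mxE.
rewrite [RHS]dotm_cols (reindex_inj (finv_inj vertex_act_inj)) dotm_cols.
by apply: eq_bigr => i _; rewrite !colmu dotm_mul_orthogonal.
Qed.

Lemma pi_e_dot w z : dotm (pi_e C g w) (pi_e C g z) = dotm w z.
Proof.
rewrite !dotmE !big_ord1 [RHS](reindex_inj (finv_inj edge_act_inj)).
by apply: eq_bigr => i _; rewrite !mxE.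
Qed.

Lemma Hv_split x : x \in Hv C g <-> x.1 \in F_space C g /\ x.2 \in E_space g.
Proof.
have unitT : T \in unitmx by case: (mulmx1_unit T_orthogonal).
split=> [/mem_Hv|[/mem_F_space muu /mem_E_space comm]]; last first.
  apply/mem_Hv; rewrite /pi_v muu -comm -mulmxA mulmxV // mulmx1.
  by case: x {muu comm}.
case: x => u A [muu TA]; split; first exact/mem_F_space.
by apply/mem_E_space => /=; rewrite -{1}TA mulmxKV.
Qed.

Lemma dim_Hv : \dim (Hv C g) = (\dim (F_space C g) + \dim (E_space g))%N.
Proof.
have [p pE] : exists p : 'Hom(vel R d t, 'M[R]_d), p =1 snd.
  by apply: linear_hom.
have [i iE] : exists i : 'Hom('M[R]_(d, t), vel R d t), i =1 fun u => (u, 0).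
  by apply: linear_hom => a u v; congr pair; rewrite /= scaler0 addr0.
have dimiF : \dim (i @: F_space C g) = \dim (F_space C g).
  apply: limg_dim_eq; apply/eqP; rewrite -subv0; apply/subvP => u.
  by rewrite memv_cap memv_ker memv0 iE => /andP[_ /eqP[->]].
rewrite -(limg_ker_dim p) -dimiF; congr addn; congr (\dim _).
  apply/vspaceP => x; rewrite memv_cap memv_ker pE.
  apply/andP/memv_imgP => [[/Hv_split[x1F _] /eqP x20]|[u uF ->]].
    by exists x.1; rewrite // iE -x20 -surjective_pairing.
  by rewrite iE eqxx; split=> //; apply/Hv_split; rewrite mem0v.
apply/vspaceP => A; apply/memv_imgP/idP => [[x /Hv_split[_ x2E] ->]|AE].
  by rewrite pE.
by exists (0, A); rewrite ?pE //; apply/Hv_split; rewrite mem0v.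
Qed.

Lemma rigidity_map_Hv x : x \in Hv C g -> rigidity_map C x \in He C g.
Proof.
move=> xHv; apply/mem_He.
by rewrite -rigidity_map_pi_v (proj1 (mem_Hv _ _ _) xHv).
Qed.

(** The vector q representing u |-> <w, R(u, 0)> satisfies <q, mu u> = <q, u> by
    equivariance, hence |mu q - q|^2 = 2 (<q, q> - <q, mu q>) = 0: it is fixed
    by mu, and (q, 0) is a symmetric velocity. *)
Lemma Hstr_orthogonal w : w \in Hstr C g <->
  w \in He C g /\ forall x, x \in Hv C g -> dotm w (rigidity_map C x) = 0.
Proof.
split=> [/mem_Hstr[wHe worth]|[wHe worth]].
  by split=> // x /Hv_split[_ xE]; apply: worth.
apply/mem_Hstr; split=> // x xE.
have /mem_He piw := wHe.
have [a u v|q qE] := dotm_riesz _ _ (fun u => dotm w (rigidity_map C (u, 0))) _.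
  rewrite -dotm_linearr -rigidity_map_linear; congr (dotm _ (rigidity_map C _)).
  by congr pair; rewrite /= scaler0 addr0.
have mu_adj u : dotm q (mu_v C g u) = dotm q u.
  rewrite -!qE -[RHS]pi_e_dot piw -rigidity_map_pi_v.
  by rewrite /pi_v /= mulmx0 mul0mx.
have muq : mu_v C g q = q.
  apply/eqP; rewrite -subr_eq0; apply/eqP/dotm_eq0.
  rewrite !dotm_bilinear mu_v_dot (dotmC _ q) !mu_adj; ring.
have q0 : q = 0.
  apply: dotm_eq0; rewrite -qE; apply: worth; apply/Hv_split.
  by rewrite mem0v; split=> //; apply/mem_F_space.
have -> : x = 1 *: (x.1, 0) + (0, x.2) :> vel R d t.
  by case: x {xE} => u A; congr pair; rewrite /= scale1r ?addr0 ?add0r.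
rewrite rigidity_map_linear dotm_linearr qE q0 dot0m mulr0 add0r.
by apply: worth; apply/Hv_split; rewrite mem0v.
Qed.

End Separable.
End Symmetry.
End Crystal.

(** * The counting formula *)

Theorem theorem3p5 (R : realType) (d t n : nat) (C : crystal_framework R d t n)
    (g : 'cV[R]_d -> 'cV[R]_d) (hg : space_group C g)
    (hsemi : semiseparable C g)
    (hsep : separable C g \/ acts_on_motif_vertices C g) :
  (m_dim C g)%:Z - (s_dim C g)%:Z =
  (\dim (F_space C g))%:Z + (\dim (E_space g))%:Z
    - (e_dim C g)%:Z - (f_dim C g)%:Z.
Proof.
have [Rm RmE] : exists Rm : 'Hom(vel R d t, 'cV[R]_n), Rm =1 rigidity_map C.
  by apply: linear_hom => a x y; apply: rigidity_map_linear.
have rank : (\dim (Hfl C g) + \dim (Rm @: Hv C g) = \dim (Hv C g))%N.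
  rewrite -(limg_ker_dim Rm (Hv C g)); congr addn; congr (\dim _).
  apply/vspaceP => x; rewrite memv_cap memv_ker RmE.
  apply/idP/andP => [/mem_Hfl[-> _ ->]//|[xHv /eqP Rx0]].
  by apply/mem_Hfl; have /(Hv_split _ _ hg)[_ xE] := xHv.
have mech : (m_dim C g + f_dim C g = \dim (Hfl C g))%N.
  apply: (@dim_orthogonal_complement _ _ (@vel_dot R d t)).
  - by move=> y a x1 x2; rewrite /vel_dot !dotm_bilinear mulrDr addrACA.
  - by move=> x y; rewrite /vel_dot dotmC (dotmC x.2).
  - move=> [u A]; rewrite /vel_dot /= => /eqP.
    rewrite paddr_eq0 ?dotm_ge0 // => /andP[/eqP u0 /eqP A0].
    by rewrite (dotm_eq0 _ _ _ u0) (dotm_eq0 _ _ _ A0).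
  - apply/subvP => x /mem_Hrig[xHv xrig]; apply/mem_Hfl.
    have /(Hv_split _ _ hg)[_ xE] := xHv; split=> //.
    by apply/colP => e; rewrite rigidity_map_strain rigid_motion_strain ?mxE.
  - by move=> x; apply: mem_Hmech.
have str : (s_dim C g + \dim (Rm @: Hv C g) = e_dim C g)%N.
  apply: (@dim_orthogonal_complement _ _ (@dotm R n 1)).
  - by move=> y a x1 x2; rewrite !dotm_bilinear.
  - exact: dotmC.
  - exact: dotm_eq0.
  - apply/subvP => _ /memv_imgP[x xHv ->]; rewrite RmE.
    exact: rigidity_map_Hv.
  - move=> w; split=> [/(Hstr_orthogonal _ _ hg hsemi hsep)[wHe worth]|].
      by split=> // _ /memv_imgP[x xHv ->]; rewrite RmE; apply: worth.
    move=> [wHe worth]; apply/(Hstr_orthogonal _ _ hg hsemi hsep).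
    split=> // x xHv.
    by rewrite -RmE; apply: worth; apply: memv_img.
have := dim_Hv _ _ hg; lia.
Qed.
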